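(* Consider linear search where the origin is the top of a symmetric hill: the robot moves with unit speed when moving towards the origin (uphill) and with constant acceleration $c>0$ when moving away from the origin (downhill). Let $D=\{1,2,2^2,\ldots\}$ be the doubling strategy. Then $\sigma_D(d)=\Theta(\sqrt{d})$ as $d\to\infty$, and this is optimal: for every zig-zag strategy $X$, $\sigma_X(d)=\Omega(\sqrt{d})$.
   Context: Downhill motion: when moving away from the origin the robot's speed increases at constant rate $c$ starting from its speed when leaving the origin (the robot starts at rest at the origin; after moving uphill at unit speed it passes the origin with speed $1$, so at time $t$ later its speed is $1+ct$ and covering distance $x$ downhill takes time $(\sqrt{1+2cx}-1)/c$). A robot starts at the origin of the real line and searches for a stationary target at an unknown point at distance $d$ from the origin (on either side). A zig-zag strategy is an infinite sequence $X=\{x_k\}_{k\ge1}$ of positive reals with $x_k<x_{k+2}$ for all $k$; the zig-zag search with strategy $X$ proceeds in rounds $k=1,2,\dots$: in an odd (resp. even) round the robot moves right (resp. left) from the origin a distance $x_k$, stopping if it reaches the target, and otherwise turns and returns to the origin. $\sigma_X(d)$ denotes the ratio between the time the robot using $X$ needs to reach a target at distance $d$ (worst case over the target being at $+d$ or $-d$) and the time an omniscient robot, knowing the target's location and starting from rest at the origin under the same movement rules, needs to travel directly to the target (time $\sqrt{2d/c}$). The constants in $\Theta,\Omega$ depend only on $c$. *)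

(* Defs.v *)
From HB Require Import structures.
From mathcomp Require Import all_boot all_order all_algebra.
From mathcomp Require Import all_classical all_reals all_analysis.
From mathcomp Require Import ring lra.

Set Implicit Arguments.
Unset Strict Implicit.
Unset Printing Implicit Defensive.

Import Order.TTheory GRing.Theory Num.Theory.

Local Open Scope classical_set_scope.
Local Open Scope ring_scope.

(* Time to run downhill over a distance x, leaving the origin with speed v and
   accelerating at rate c: the nonnegative root t of v t + c t^2 / 2 = x
   (see [downhill_timeP]). *)
Definition downhill_time (R : realType) (c v x : R) : R :=
  (Num.sqrt (v ^+ 2 + 2 * c * x) - v) / c.

Definition uphill_time (R : realType) (x : R) : R := x.

(* Rounds are numbered from 1. The robot starts at rest, hence speed 0 in
   round 1; every later round starts by passing the origin at the end of a
   unit-speed climb. *)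
Definition start_speed (R : realType) (k : nat) : R := if (k <= 1)%N then 0 else 1.

(* A strategy is x : nat -> R read at indices k >= 1; x 0 is never used. *)
Definition zigzag (R : realType) (x : nat -> R) : Prop :=
  forall k : nat, (1 <= k)%N -> 0 < x k /\ x k < x k.+2.

Definition doubling (R : realType) (k : nat) : R := 2 ^+ k.-1.

Definition round_time (R : realType) (c : R) (x : nat -> R) (k : nat) : R :=
  downhill_time c (start_speed R k) (x k) + uphill_time (x k).

(* Odd rounds explore the right side of the origin, even rounds the left. *)
Definition reaches (R : realType) (x : nat -> R) (k : nat) (p : R) : Prop :=
  if odd k then 0 < p /\ p <= x k else p < 0 /\ - p <= x k.

(* Time at which the robot is at point p in round k, provided
   [reaches x k p] holds. *)
Definition arrival_time (R : realType) (c : R) (x : nat -> R) (k : nat) (p : R) : R :=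
  \sum_(1 <= j < k) round_time c x j + downhill_time c (start_speed R k) `|p|.

(* First arrival at a target located at p; +oo when no round reaches p, which
   a bounded strategy allows. *)
Definition search_time (R : realType) (c : R) (x : nat -> R) (p : R) : \bar R :=
  ereal_inf [set (arrival_time c x k p)%:E | k in
    [set k : nat | (1 <= k)%N /\ reaches x k p]].

Definition omniscient_time (R : realType) (c d : R) : R := downhill_time c 0 d.

Definition sigma (R : realType) (c : R) (x : nat -> R) (d : R) : \bar R :=
  (Order.max (search_time c x d) (search_time c x (- d)) *
   ((omniscient_time c d)^-1)%:E)%E.

Lemma downhill_timeP (R : realType) (c v x : R) : 0 < c -> 0 <= v -> 0 <= x ->
  let t := downhill_time c v x in 0 <= t /\ v * t + c * t ^+ 2 / 2 = x.
Proof.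
move=> c0 v0 x0 /=; rewrite /downhill_time; set s := Num.sqrt _.
have cx0 : 0 <= c * x by apply: mulr_ge0 => //; exact: ltW.
have rad0 : 0 <= v ^+ 2 + 2 * c * x by have := sqr_ge0 v; lra.
have s2 : s ^+ 2 = v ^+ 2 + 2 * c * x by rewrite sqr_sqrtr.
split.
  apply: divr_ge0; last exact: ltW.
  by rewrite subr_ge0 -[v](ger0_norm v0) -sqrtr_sqr ler_wsqrtr //; lra.
have cn0 : c != 0 by rewrite gt_eqF.
have -> : v * ((s - v) / c) + c * ((s - v) / c) ^+ 2 / 2 =
  (s ^+ 2 - v ^+ 2) / (2 * c) by field.
by rewrite s2; field.
Qed.

Lemma omniscient_timeE (R : realType) (c d : R) : 0 < c -> 0 <= d ->
  omniscient_time c d = Num.sqrt (2 * d / c).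
Proof.
move=> c0 d0; rewrite /omniscient_time /downhill_time expr0n /= add0r subr0.
have cn0 : c != 0 by rewrite gt_eqF.
have -> : 2 * c * d = c ^+ 2 * (2 * d / c) by field.
rewrite sqrtrM ?sqr_ge0 // sqrtr_sqr ger0_norm ?ltW //.
by field.
Qed.

Lemma doubling_zigzag (R : realType) : zigzag (@doubling R).
Proof.
move=> [//|k] _; rewrite /doubling /=; split; first by rewrite exprn_gt0.
by rewrite ltr_eXn2l // ltr1n.
Qed.

(* Main.v *)
Require Import Defs.
From HB Require Import structures.
From mathcomp Require Import all_boot all_order all_algebra.
From mathcomp Require Import all_classical all_reals all_analysis.
From mathcomp Require Import ring lra.

Set Implicit Arguments.
Unset Strict Implicit.
Unset Printing Implicit Defensive.

Import Order.TTheory GRing.Theory Num.Theory.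

Local Open Scope ring_scope.

(* Lower bound: of two rounds reaching d and -d, the earlier one is followed by
   a climb back of length at least d at unit speed, so the worse of the two
   targets costs time at least d, against sqrt (2 d / c) for the omniscient
   robot. Upper bound: a doubling round of length x >= 1 takes time O(x), these
   lengths form a geometric progression, and each of d and -d is reached in a
   round of length at most 4 d. *)

Section Search.
Variables (R : realType) (c : R).
Hypothesis c_gt0 : 0 < c.
Implicit Types (x : nat -> R) (d p v : R) (k : nat).

Lemma start_speed_ge0 k : 0 <= start_speed R k.
Proof. by rewrite /start_speed; case: ifP. Qed.

Lemma start_speed_le1 k : start_speed R k <= 1.
Proof. by rewrite /start_speed; case: ifP. Qed.

Lemma downhill_time_ge0 v d : 0 <= v -> 0 <= d -> 0 <= downhill_time c v d.
Proof. by move=> v0 d0; have [] := downhill_timeP c_gt0 v0 d0. Qed.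

(** From [sqrt y <= y] for [y >= 1], taken at [y = 1 + 2 * c * d]. A bound linear in [d] suffices,
    since the climb back is linear anyway. *)
Lemma downhill_time_le v d : 0 <= v <= 1 -> 1 <= d ->
  downhill_time c v d <= (1 + 2 * c) / c * d.
Proof.
move=> /andP[v0 v1] d1; rewrite /downhill_time [leRHS]mulrAC ler_pM2r ?invr_gt0 //.
have cd : c <= c * d by rewrite ler_peMr // ltW.
have v2 : v ^+ 2 <= 1 by rewrite expr_le1.
have cc := c_gt0.
suff : Num.sqrt (v ^+ 2 + 2 * c * d) <= 1 + 2 * c * d by lra.
have y1 : 1 <= 1 + 2 * c * d by lra.
rewrite -[leRHS]ger0_norm; last lra.
rewrite -sqrtr_sqr ler_wsqrtr //.
apply: (@le_trans _ _ (1 + 2 * c * d)); first lra.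
by rewrite expr2 ler_peMl //; lra.
Qed.

Lemma round_time_ge x k : zigzag x -> (1 <= k)%N -> x k <= round_time c x k.
Proof.
move=> xz k1; have [xk _] := xz _ k1.
by rewrite lerDr downhill_time_ge0 ?start_speed_ge0 // ltW.
Qed.

Lemma round_time_ge0 x k : zigzag x -> (1 <= k)%N -> 0 <= round_time c x k.
Proof.
move=> xz k1; have [xk _] := xz _ k1.
by apply: le_trans (round_time_ge xz k1); exact: ltW.
Qed.

Lemma reaches_norm x k p : reaches x k p -> `|p| <= x k.
Proof.
rewrite /reaches; case: ifP => _ [p0 px].
  by rewrite gtr0_norm.
by rewrite ltr0_norm.
Qed.

(** Round [i] is completed before round [j] starts, and its climb alone lasts [x i >= |p|]; wherever
    [q] lies, all other contributions are nonnegative. *)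
Lemma arrival_time_ge x i j p q : zigzag x -> (1 <= i < j)%N ->
  reaches x i p -> `|p| <= arrival_time c x j q.
Proof.
move=> xz /andP[i1 ij] /reaches_norm /le_trans; apply.
apply: le_trans (round_time_ge xz i1) _.
(* Split the sum at [i] to isolate the term of round [i]. *)
rewrite /arrival_time (big_cat_nat (n := i.+1)) //= big_nat_recr //= -addrA.
rewrite addrCA -addrA lerDl -addrA addr_ge0 //.
  by rewrite big_nat sumr_ge0 // => l /andP[l1 _]; exact: round_time_ge0.
rewrite addr_ge0 ?downhill_time_ge0 ?start_speed_ge0 //.
rewrite big_nat sumr_ge0 // => l /andP[l1 _].
by apply: round_time_ge0 => //; exact: leq_trans l1.
Qed.

Lemma search_time_max_ge x d : zigzag x -> 0 < d ->
  (d%:E <= Order.max (search_time c x d) (search_time c x (- d)))%E.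
Proof.
move=> xz d0; rewrite le_max.
have [//|lt_d] := leP d%:E (search_time c x d).
(* Some round [i] reaches [d] before time [d]. It remains to bound below the arrival at [-d] in
   every round [j]; if there is no such round, the infimum is [+oo]. *)
have [_ [i /= [i1 ri] <-]] := ereal_inf_lt lt_d; rewrite lte_fin => ai.
apply: le_ereal_inf_tmp => _ [j /= [j1 rj] <-]; rewrite lee_fin.
have [ij|ji|eij] := ltngtP i j.
- rewrite -[leLHS](gtr0_norm d0).
  by apply: (arrival_time_ge _ _ _ ri) => //; rewrite i1.
- have := @arrival_time_ge x j i (- d) d xz; rewrite j1 ji normrN gtr0_norm //.
  by move=> /(_ isT rj); rewrite leNgt ai.
- by move: ri rj; rewrite /reaches eij; case: ifP => _ [? _] [? _]; lra.
Qed.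

(** Converts search times linear in [d] into ratios of order [sqrt d]. *)
Lemma omniscient_time_inv d : 0 < d ->
  d / omniscient_time c d = (Num.sqrt (2 / c))^-1 * Num.sqrt d.
Proof.
move=> d0; rewrite omniscient_timeE ?ltW //.
have c2 : 0 < 2 / c by rewrite divr_gt0.
rewrite mulrAC sqrtrM ?ltW // invfM -{1}(sqr_sqrtr (ltW d0)).
have sd : Num.sqrt d != 0 by rewrite gt_eqF ?sqrtr_gt0.
have s2c : Num.sqrt (2 / c) != 0 by rewrite gt_eqF ?sqrtr_gt0.
by field; rewrite s2c sd.
Qed.

Lemma omniscient_time_ge0 d : 0 < d -> 0 <= omniscient_time c d.
Proof. by move=> d0; exact: downhill_time_ge0 (lexx _) (ltW d0). Qed.

Lemma sigma_ge x d : zigzag x -> 0 < d ->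
  (((Num.sqrt (2 / c))^-1 * Num.sqrt d)%:E <= sigma c x d)%E.
Proof.
move=> xz d0; rewrite -omniscient_time_inv // EFinM /sigma.
apply: lee_wpmul2r (search_time_max_ge xz d0).
by rewrite lee_fin invr_ge0 omniscient_time_ge0.
Qed.

Lemma search_time_le x k p : (1 <= k)%N -> reaches x k p ->
  (search_time c x p <= (arrival_time c x k p)%:E)%E.
Proof. by move=> k1 rk; apply: ereal_inf_lbound; exists k. Qed.

(** Time per unit length of a doubling round: the first summand bounds the descent, the [1] is the
    unit-speed climb. *)
Let K := (1 + 2 * c) / c + 1.

Let K_gt0 : 0 < K.
Proof.
have cc := c_gt0.
have : 0 < (1 + 2 * c) / c by rewrite divr_gt0 //; lra.
by rewrite /K; lra.
Qed.

Lemma doubling_ge1 k : 1 <= doubling R k.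
Proof. by rewrite /doubling exprn_ege1 // ler1n. Qed.

Lemma round_time_doubling_le k : round_time c (@doubling R) k <= K * doubling R k.
Proof.
rewrite /round_time /uphill_time mulrDl mul1r lerD2r downhill_time_le //.
  by rewrite start_speed_ge0 start_speed_le1.
exact: doubling_ge1.
Qed.

Lemma sum_doubling k : (1 <= k)%N ->
  \sum_(1 <= j < k) doubling R j = doubling R k - 1.
Proof.
elim: k => [//|[|k] IH] _; first by rewrite big_geq // subrr.
by rewrite big_nat_recr //= IH // /doubling /= exprS; ring.
Qed.

(** The rounds before [k] have total length below [doubling R k], hence cost at most
    [K * (4 * |p|)]; the final descent adds at most [K * |p|]. *)
Lemma arrival_time_doubling_le k p : (1 <= k)%N -> 1 <= `|p| ->
  doubling R k <= 4 * `|p| ->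
  arrival_time c (@doubling R) k p <= 5 * K * `|p|.
Proof.
move=> k1 p1 kp; have -> : 5 * K * `|p| = K * (4 * `|p|) + K * `|p| by ring.
apply: lerD.
  apply: (@le_trans _ _ (\sum_(1 <= j < k) K * doubling R j)).
    by apply: ler_sum => j _; exact: round_time_doubling_le.
  by rewrite -mulr_sumr sum_doubling // ler_wpM2l ?ltW //; lra.
apply: (@le_trans _ _ ((1 + 2 * c) / c * `|p|)).
  by apply: downhill_time_le; rewrite ?start_speed_ge0 ?start_speed_le1.
by rewrite /K [leRHS]mulrDl mul1r lerDl.
Qed.

Lemma exists_doubling_reaches p : 1 <= `|p| ->
  exists k, [/\ (1 <= k)%N, reaches (@doubling R) k p & doubling R k <= 4 * `|p|].
Proof.
move=> p1.
have exn : exists n, `|p| <= 2 ^+ n.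
  by exists (Num.bound `|p|); apply/ltW/upper_nthrootP.
(* By minimality [2 ^+ n <= 2 * |p|]; for [n = 0] this uses [1 <= |p|]. *)
have [n pn n_min] := ex_minnP exn.
have n2 : 2 ^+ n <= 2 * `|p|.
  case: n n_min {pn} => [|n] n_min; first by rewrite expr0; lra.
  rewrite exprS ler_pM2l // leNgt; apply/negP => /ltW /n_min.
  by rewrite ltnn.
have pn2 : `|p| <= 2 ^+ n.+1 by rewrite exprS; lra.
have reach k : odd k = (0 < p) -> `|p| <= doubling R k ->
    reaches (@doubling R) k p.
  rewrite /reaches => ->; case: (ltrgt0P p) => [p0|p0|p0] pk.
  - by split.
  - by split.
  - by move: p1; rewrite p0 normr0 ler10.
(* Round [n.+1] has length [2 ^+ n]. If it explores the wrong side, the next round, twice as long,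
   reaches [p]; hence the factor 4. *)
have [odd_n|even_n] := boolP (odd n.+1 == (0 < p)).
  exists n.+1; split=> //; last by rewrite /doubling /=; lra.
  by apply: reach => //; apply/eqP.
exists n.+2; split=> //; last by rewrite /doubling /= exprS; lra.
by apply: reach => //; move: even_n => /=; case: (odd n); case: (0 < p).
Qed.

Lemma search_time_doubling_le p : 1 <= `|p| ->
  (search_time c (@doubling R) p <= (5 * K * `|p|)%:E)%E.
Proof.
move=> p1; have [k [k1 rk kp]] := exists_doubling_reaches p1.
apply: le_trans (search_time_le k1 rk) _.
by rewrite lee_fin arrival_time_doubling_le.
Qed.

Lemma sigma_doubling_le : exists2 b : R, 0 < b & forall d, 1 <= d ->
  (sigma c (@doubling R) d <= (b * Num.sqrt d)%:E)%E.
Proof.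
exists (5 * K * (Num.sqrt (2 / c))^-1).
  by rewrite !mulr_gt0 // invr_gt0 sqrtr_gt0 divr_gt0.
move=> d d1; have d0 : 0 < d by lra.
rewrite -mulrA -omniscient_time_inv // mulrA EFinM /sigma.
apply: lee_wpmul2r; first by rewrite lee_fin invr_ge0 omniscient_time_ge0.
rewrite -{2 3}(gtr0_norm d0) ge_max search_time_doubling_le ?gtr0_norm //=.
by rewrite -{2}(gtr0_norm d0) -normrN search_time_doubling_le // normrN gtr0_norm.
Qed.

End Search.

Theorem theorem6 (R : realType) (c : R) (hc : 0 < c) :
  (exists a b d0 : R, [/\ 0 < a, 0 < b, 0 < d0 &
     forall d : R, d0 <= d ->
       ((a * Num.sqrt d)%:E <= sigma c (@doubling R) d)%E /\
       (sigma c (@doubling R) d <= (b * Num.sqrt d)%:E)%E]) /\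
  (exists a d0 : R, [/\ 0 < a, 0 < d0 &
     forall x : nat -> R, zigzag x -> forall d : R, d0 <= d ->
       ((a * Num.sqrt d)%:E <= sigma c x d)%E]).
Proof.
have a_gt0 : 0 < (Num.sqrt (2 / c))^-1 by rewrite invr_gt0 sqrtr_gt0 divr_gt0.
have [b b_gt0 upper] := sigma_doubling_le hc.
split; last first.
  exists (Num.sqrt (2 / c))^-1, 1; split=> // x xz d d1.
  by apply: sigma_ge => //; exact: lt_le_trans d1.
(* The lower bound is the general one applied to doubling; the threshold 1 comes from the upper
   bound. *)
exists (Num.sqrt (2 / c))^-1, b, 1; split=> // d d1; split; last exact: upper.
by apply: sigma_ge => //; [exact: doubling_zigzag|exact: lt_le_trans d1].
Qed.
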